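(* There exists a polynomial time algorithm which, given an $\mathsf{NJp}$-derivation $d$ of a sequent $\Gamma\Rightarrow\alpha_0\lor\alpha_1$ with a Harrop antecedent $\Gamma$, outputs an $i\in\{0,1\}$ together with a $(cut)$-deduction of a sequent $\Gamma'\Rightarrow\alpha_i$ with $\Gamma'\subseteq\Gamma$ from the set consisting of the sequents occurring in $d$, the sequents $\Gamma\Rightarrow\gamma$ for each $\gamma\in\Gamma$, and the sequents in $\bigcup\{\mathcal{C}(\gamma):\gamma\in\Gamma\}$.
   Context: Formulas are propositional formulas built from atoms and $\bot$ with $\lor,\land,\supset$; a cedent is a finite set of formulas, a sequent $\Gamma\Rightarrow\alpha$ pairs a cedent with a formula. $\mathsf{NJp}$ has axioms $\alpha,\Gamma\Rightarrow\alpha$ and $\bot,\Gamma\Rightarrow p$ ($p$ atom) and rules $(\lor E)$: from $\Gamma\Rightarrow\alpha_0\lor\alpha_1$, $\alpha_0,\Gamma\Rightarrow\beta$, $\alpha_1,\Gamma\Rightarrow\beta$ infer $\Gamma\Rightarrow\beta$; $(\lor I)$: from $\Gamma\Rightarrow\alpha_i$ infer $\Gamma\Rightarrow\alpha_0\lor\alpha_1$; $(\land E)$: from $\Gamma\Rightarrow\alpha_0\land\alpha_1$ infer $\Gamma\Rightarrow\alpha_i$; $(\land I)$: from $\Gamma\Rightarrow\alpha_0$, $\Gamma\Rightarrow\alpha_1$ infer $\Gamma\Rightarrow\alpha_0\land\alpha_1$; $(\supset E)$: from $\Gamma\Rightarrow\alpha\supset\beta$, $\Gamma\Rightarrow\alpha$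 infer $\Gamma\Rightarrow\beta$; $(\supset I)$: from $\alpha,\Gamma\Rightarrow\beta$ infer $\Gamma\Rightarrow\alpha\supset\beta$. Strictly positive occurrence: $\alpha$ itself; strictly positive in $\alpha_i$ when $\alpha$ is $\alpha_0\lor\alpha_1$ or $\alpha_0\land\alpha_1$; strictly positive in $\alpha_1$ when $\alpha$ is $\alpha_0\supset\alpha_1$. A Harrop formula has no strictly positive disjunction; a Harrop cedent consists of Harrop formulas. $\mathcal{C}(\gamma)$ is the set of sequents defined by: $\mathcal{C}(\gamma)=\emptyset$ if $\gamma$ is an atom, $\bot$ or a disjunction; $\mathcal{C}(\alpha\supset\beta)=\{\alpha,\alpha\supset\beta\Rightarrow\beta\}\cup\mathcal{C}(\beta)$; $\mathcal{C}(\alpha_0\land\alpha_1)=\{\alpha_0\land\alpha_1\Rightarrow\alpha_i:i=0,1\}\cup\mathcal{C}(\alpha_0)\cup\mathcal{C}(\alpha_1)$. A $(cut)$-deduction from a set $\mathcal{S}$ of sequents is a finite tree of sequents whose leaves belong to $\mathcal{S}$ and all of whose inferences are $(cut)$: from $\Gamma\Rightarrow\beta$ and $\beta,\Delta\Rightarrow\alpha$ infer $\Gamma,\Delta\Rightarrow\alpha$. *)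

(* Defs.v *)
From HB Require Import structures.
From mathcomp Require Import all_boot finmap.

Set Implicit Arguments.
Unset Strict Implicit.
Unset Printing Implicit Defensive.

Local Open Scope fset_scope.

(* There are countably many atoms; each is named by a word over {0,1}, so that
   the size of an atom is the length of its name. *)
Definition atom := seq bool.

Inductive form :=
| Atom of atom
| Bot
| Or of form & form
| And of form & form
| Imp of form & form.

Fixpoint form_tree (a : form) : GenTree.tree atom :=
  match a with
  | Atom p => GenTree.Leaf p
  | Bot => GenTree.Node 0 [::]
  | Or a0 a1 => GenTree.Node 1 [:: form_tree a0; form_tree a1]
  | And a0 a1 => GenTree.Node 2 [:: form_tree a0; form_tree a1]
  | Imp a0 a1 => GenTree.Node 3 [:: form_tree a0; form_tree a1]
  end.

Fixpoint tree_form (t : GenTree.tree atom) : form :=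
  match t with
  | GenTree.Leaf p => Atom p
  | GenTree.Node 1 [:: t0; t1] => Or (tree_form t0) (tree_form t1)
  | GenTree.Node 2 [:: t0; t1] => And (tree_form t0) (tree_form t1)
  | GenTree.Node 3 [:: t0; t1] => Imp (tree_form t0) (tree_form t1)
  | _ => Bot
  end.

Lemma form_treeK : cancel form_tree tree_form.
Proof. by elim=> //= a0 -> a1 ->. Qed.

HB.instance Definition _ := Countable.copy form (can_type form_treeK).

Definition cedent := {fset form}.
Definition sequent := (cedent * form)%type.

(* [strictly_positive b a]: [b] has a strictly positive occurrence in [a]. *)
Inductive strictly_positive (b : form) : form -> Prop :=
| SP_self : strictly_positive b b
| SP_or0 a0 a1 : strictly_positive b a0 -> strictly_positive b (Or a0 a1)
| SP_or1 a0 a1 : strictly_positive b a1 -> strictly_positive b (Or a0 a1)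
| SP_and0 a0 a1 : strictly_positive b a0 -> strictly_positive b (And a0 a1)
| SP_and1 a0 a1 : strictly_positive b a1 -> strictly_positive b (And a0 a1)
| SP_imp a0 a1 : strictly_positive b a1 -> strictly_positive b (Imp a0 a1).

Definition Harrop (a : form) : Prop :=
  forall b0 b1, ~ strictly_positive (Or b0 b1) a.

Definition Harrop_cedent (G : cedent) : Prop :=
  forall a, a \in G -> Harrop a.

(* [Node s ts]: the sequent [s] is inferred from the roots of [ts]. *)
Inductive tree := Node of sequent & seq tree.

Fixpoint sequents_of (d : tree) : {fset sequent} :=
  let: Node s ts := d in
  s |` foldr (fun t S => sequents_of t `|` S) fset0 ts.

(* [NJp s d]: the tree [d] is an NJp-derivation of [s].  The index i of the
   disjunct or conjunct is a boolean: 0 is [false], 1 is [true]. *)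
Inductive NJp : sequent -> tree -> Prop :=
| NJ_ax (G : cedent) a :
    NJp (a |` G, a) (Node (a |` G, a) [::])
| NJ_bot (G : cedent) p :
    NJp (Bot |` G, Atom p) (Node (Bot |` G, Atom p) [::])
| NJ_orE (G : cedent) a0 a1 b d d0 d1 :
    NJp (G, Or a0 a1) d -> NJp (a0 |` G, b) d0 -> NJp (a1 |` G, b) d1 ->
    NJp (G, b) (Node (G, b) [:: d; d0; d1])
| NJ_orI (G : cedent) (i : bool) a0 a1 d :
    NJp (G, if i then a1 else a0) d ->
    NJp (G, Or a0 a1) (Node (G, Or a0 a1) [:: d])
| NJ_andE (G : cedent) (i : bool) a0 a1 d :
    NJp (G, And a0 a1) d ->
    NJp (G, if i then a1 else a0) (Node (G, if i then a1 else a0) [:: d])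
| NJ_andI (G : cedent) a0 a1 d0 d1 :
    NJp (G, a0) d0 -> NJp (G, a1) d1 ->
    NJp (G, And a0 a1) (Node (G, And a0 a1) [:: d0; d1])
| NJ_impE (G : cedent) a b d0 d1 :
    NJp (G, Imp a b) d0 -> NJp (G, a) d1 ->
    NJp (G, b) (Node (G, b) [:: d0; d1])
| NJ_impI (G : cedent) a b d :
    NJp (a |` G, b) d ->
    NJp (G, Imp a b) (Node (G, Imp a b) [:: d]).

(* [cut_deduction S s e]: the tree [e] is a (cut)-deduction of [s] from [S]. *)
Inductive cut_deduction (S : {fset sequent}) : sequent -> tree -> Prop :=
| Cut_leaf s : s \in S -> cut_deduction S s (Node s [::])
| Cut_cut (G D : cedent) a b e0 e1 :
    cut_deduction S (G, b) e0 -> cut_deduction S (b |` D, a) e1 ->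
    cut_deduction S (G `|` D, a) (Node (G `|` D, a) [:: e0; e1]).

Fixpoint Cseq (c : form) : {fset sequent} :=
  match c with
  | Atom _ | Bot | Or _ _ => fset0
  | And a0 a1 =>
      [fset ([fset And a0 a1], a0); ([fset And a0 a1], a1)]
        `|` Cseq a0 `|` Cseq a1
  | Imp a b => ([fset a; Imp a b], b) |` Cseq b
  end.

Definition cut_premises (G : cedent) (d : tree) : {fset sequent} :=
  sequents_of d `|` [fset (G, c) | c in G] `|` \bigcup_(c <- G) Cseq c.

(* The model of computation is Jones's imperative language WHILE over binary
   trees ("Computability and Complexity from a Programming Perspective"), a
   tree being written with [dsize] symbols.  Instead of Jones's unit cost, the
   evaluation of an expression is charged the total size of all the trees that
   it produces, including the intermediate ones.  This excludes the building
   of exponentially large trees by repeated sharing (X := cons X X), so running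
   times agree with those of Turing machines up to a polynomial, also for
   functions with large outputs. *)
Inductive data := Leaf | Pair of data & data.

Fixpoint dsize (x : data) : nat :=
  if x is Pair y z then (dsize y + dsize z).+1 else 1.

Fixpoint data_eqb (x y : data) : bool :=
  match x, y with
  | Leaf, Leaf => true
  | Pair x0 x1, Pair y0 y1 => data_eqb x0 y0 && data_eqb x1 y1
  | _, _ => false
  end.

Definition of_bool (b : bool) : data := if b then Pair Leaf Leaf else Leaf.

Inductive expr :=
| Var of nat
| Quote of data
| Cons of expr & expr
| Hd of expr
| Tl of expr
| Eq of expr & expr.

Inductive cmd :=
| Assign of nat & expr
| Seq of cmd & cmd
| If of expr & cmd & cmd
| While of expr & cmd.

Definition store := nat -> data.

Definition update (s : store) (v : nat) (x : data) : store :=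
  fun w => if w == v then x else s w.

Fixpoint eval (s : store) (e : expr) : data :=
  match e with
  | Var v => s v
  | Quote x => x
  | Cons e0 e1 => Pair (eval s e0) (eval s e1)
  | Hd e => if eval s e is Pair x _ then x else Leaf
  | Tl e => if eval s e is Pair _ y then y else Leaf
  | Eq e0 e1 => of_bool (data_eqb (eval s e0) (eval s e1))
  end.

Fixpoint cost (s : store) (e : expr) : nat :=
  dsize (eval s e) +
  match e with
  | Var _ | Quote _ => 0
  | Hd e | Tl e => cost s e
  | Cons e0 e1 | Eq e0 e1 => cost s e0 + cost s e1
  end.

(* [exec c s s' n]: started in the store [s], the command [c] halts in the
   store [s'] after time [n].  In tests [Leaf] is false, all else is true. *)
Inductive exec : cmd -> store -> store -> nat -> Prop :=
| Exec_assign v e s :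
    exec (Assign v e) s (update s v (eval s e)) (cost s e).+1
| Exec_seq c0 c1 s s' s'' n0 n1 :
    exec c0 s s' n0 -> exec c1 s' s'' n1 -> exec (Seq c0 c1) s s'' (n0 + n1)
| Exec_if_true e c0 c1 s s' n :
    eval s e <> Leaf -> exec c0 s s' n ->
    exec (If e c0 c1) s s' (cost s e + n).+1
| Exec_if_false e c0 c1 s s' n :
    eval s e = Leaf -> exec c1 s s' n ->
    exec (If e c0 c1) s s' (cost s e + n).+1
| Exec_while_true e c s s' s'' n0 n1 :
    eval s e <> Leaf -> exec c s s' n0 -> exec (While e c) s' s'' n1 ->
    exec (While e c) s s'' (cost s e + n0 + n1).+1
| Exec_while_false e c s :
    eval s e = Leaf -> exec (While e c) s s (cost s e).+1.

(* Variable 0 holds the input, and the output at the end. *)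
Definition computes (c : cmd) (x y : data) (n : nat) : Prop :=
  exists2 s, exec c (update (fun=> Leaf) 0 x) s n & s 0 = y.

Fixpoint numeral (n : nat) : data :=
  if n is m.+1 then Pair Leaf (numeral m) else Leaf.

Definition data_of_seq (l : seq data) : data := foldr Pair Leaf l.

Fixpoint form_code (a : form) : data :=
  match a with
  | Atom p => Pair (numeral 0) (data_of_seq (map of_bool p))
  | Bot => Pair (numeral 1) Leaf
  | Or a0 a1 => Pair (numeral 2) (Pair (form_code a0) (form_code a1))
  | And a0 a1 => Pair (numeral 3) (Pair (form_code a0) (form_code a1))
  | Imp a0 a1 => Pair (numeral 4) (Pair (form_code a0) (form_code a1))
  end.

(* A finite set is written down as a list of its elements, in any order and
   possibly with repetitions; hence a relation rather than a function. *)
Definition cedent_code (G : cedent) (x : data) : Prop :=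
  exists2 l : seq form, l =i G & x = data_of_seq (map form_code l).

Definition sequent_code (s : sequent) (x : data) : Prop :=
  exists2 y, cedent_code s.1 y & x = Pair y (form_code s.2).

(* Occurrences of the same cedent may be listed differently at different
   nodes.  The names of the inference rules are not part of the code. *)
Inductive tree_code : tree -> data -> Prop :=
| Tree_code s ts x ys :
    sequent_code s x -> trees_code ts ys ->
    tree_code (Node s ts) (Pair x ys)
with trees_code : seq tree -> data -> Prop :=
| Trees_code_nil : trees_code [::] Leaf
| Trees_code_cons t ts y ys :
    tree_code t y -> trees_code ts ys -> trees_code (t :: ts) (Pair y ys).

Definition answer_code (i : bool) (e : tree) (y : data) : Prop :=
  exists2 z, tree_code e z & y = Pair (of_bool i) z.

(* Main.v *)
Require Import Defs.
From mathcomp Require Import all_boot finmap zify.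

(** Let S be the set of available sequents and let X be the set of formulas
    obtained from the formulas of Gamma by forward chaining: whenever S contains
    Delta => b with Delta included in X, add b to X.  Kleene's slash with
    membership in X in the place of provability is sound for the sequents of d,
    because X is closed under them, and holds for the Harrop formulas of Gamma,
    because X is closed under the sequents in C(gamma).  Hence alpha_0 \/ alpha_1
    is slashed, which puts some alpha_i into X.

    Forward chaining needs at most |S| passes through S and produces a log of
    the sequents that fired.  A cut-deduction of alpha_i is read off by going
    through the log backwards, each time cutting with the logged sequent
    Delta => b if b is in the current antecedent.  This is a tree of linear size
    because all the left premises are leaves.

    Polynomial time is treated by closing a class of functions on binary trees
    under composition, conditionals, and loops whose states stay polynomially
    bounded, so that the algorithm can be written as a function. *)

Set Implicit Arguments.
Unset Strict Implicit.
Unset Printing Implicit Defensive.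

Local Open Scope fset_scope.
Local Open Scope nat_scope.

(** * Polynomial-time functions on trees *)

Lemma data_eqbP x y : reflect (x = y) (data_eqb x y).
Proof.
elim: x y => [|x0 IH0 x1 IH1] [|y0 y1] /=; try by constructor.
apply: (iffP andP) => [[/IH0-> /IH1->] //|[<- <-]].
by split; [apply/IH0 | apply/IH1].
Qed.

Lemma dsize_gt0 x : 0 < dsize x.
Proof. by case: x. Qed.

Definition dhd x := if x is Pair y _ then y else Leaf.
Definition dtl x := if x is Pair _ y then y else Leaf.
Definition dif (x y z : data) := if x is Leaf then z else y.
Definition deq (x y : data) := of_bool (data_eqb x y).

Lemma dsize_hd x : dsize (dhd x) <= dsize x.
Proof. by case: x => //= x y; lia. Qed.

Lemma dsize_tl x : dsize (dtl x) <= dsize x.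
Proof. by case: x => //= x y; lia. Qed.

Lemma dif_bool b x y : dif (of_bool b) x y = if b then x else y.
Proof. by case: b. Qed.

(** One constant serves as coefficient and as exponent. Since [dsize] is at least 1, such a bound
    weakens as [k] grows, so that two bounds can be merged into one. *)
Definition polybounded (w : data -> nat) :=
  exists k, forall x, w x <= k * dsize x ^ k.

Lemma polybounded_le w w' :
  polybounded w' -> (forall x, w x <= w' x) -> polybounded w.
Proof. by move=> [k wP] le_w; exists k => x; exact: leq_trans (wP x). Qed.

Lemma polybounded_const m : polybounded (fun=> m).
Proof.
by exists m => x; rewrite leq_pmulr // expn_gt0 dsize_gt0.
Qed.

Lemma polybounded_dsize : polybounded dsize.
Proof. by exists 1 => x; rewrite mul1n expn1. Qed.

Lemma polyboundedD w w' : polybounded w -> polybounded w' ->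
  polybounded (fun x => w x + w' x).
Proof.
move=> [k wP] [k' wP']; exists (k + k') => x.
rewrite mulnDl; apply: leq_add.
  apply: leq_trans (wP x) _; apply: leq_mul => //.
  by apply: leq_pexp2l; rewrite ?dsize_gt0 ?leq_addr.
apply: leq_trans (wP' x) _; apply: leq_mul => //.
by apply: leq_pexp2l; rewrite ?dsize_gt0 ?leq_addl.
Qed.

Lemma polyboundedM w w' : polybounded w -> polybounded w' ->
  polybounded (fun x => w x * w' x).
Proof.
move=> [k wP] [k' wP']; exists (k * k' + k + k') => x.
apply: leq_trans (leq_mul (wP x) (wP' x)) _.
rewrite mulnACA -expnD; apply: leq_mul; first by lia.
by apply: leq_pexp2l; rewrite ?dsize_gt0 //; lia.
Qed.

Lemma polyboundedX w m : polybounded w -> polybounded (fun x => w x ^ m).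
Proof.
move=> wP; elim: m => [|m IH]; first exact: polybounded_const 1.
by apply: (polybounded_le (polyboundedM wP IH)) => x; rewrite expnS.
Qed.

Lemma polybounded_comp w f : polybounded w -> polybounded (dsize \o f) ->
  polybounded (w \o f).
Proof.
move=> [k wP] fP.
apply: (polybounded_le (polyboundedM (polybounded_const k) (polyboundedX k fP))).
by move=> x; exact: wP.
Qed.

(* Programs are parameterized by a variable [b] that holds the argument and
   then the result; they may use the variables from [b] on as scratch space, so
   that what is stored below [b] survives a subprogram. *)
Definition polytime (f : data -> data) :=
  exists (c : nat -> cmd) (T : data -> nat),
    [/\ polybounded T, polybounded (dsize \o f) &
      forall b s, exists s' n, [/\ exec (c b) s s' n, s' b = f (s b),
        forall v, v < b -> s' v = s v & n <= T (s b)]].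

Lemma polytime_dsize f : polytime f -> polybounded (dsize \o f).
Proof. by case=> c [T []]. Qed.

Lemma eq_polytime f g : polytime f -> f =1 g -> polytime g.
Proof.
move=> [c [T [TP fP cP]]] fg; exists c, T; split => //.
  by apply: (polybounded_le fP) => x /=; rewrite fg.
by move=> b s; have := cP b s; rewrite fg.
Qed.

Lemma polytime_comp f g : polytime f -> polytime g -> polytime (fun x => f (g x)).
Proof.
move=> [cf [Tf [TfP fP cfP]]] [cg [Tg [TgP gP cgP]]].
exists (fun b => Seq (cg b) (cf b)), (fun x => Tg x + Tf (g x)); split.
- exact: polyboundedD TgP (polybounded_comp TfP gP).
- exact: (polybounded_comp fP gP).
move=> b s; have [s1 [n1 [e1 v1 k1 t1]]] := cgP b s.
have [s2 [n2 [e2 v2 k2 t2]]] := cfP b s1.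
exists s2, (n1 + n2); split; first exact: Exec_seq e1 e2.
- by rewrite v2 v1.
- by move=> v vb; rewrite k2 ?k1.
- by apply: leq_add; rewrite // -v1.
Qed.

Lemma polytime_expr (e : nat -> expr) f :
  (forall b s, eval s (e b) = f (s b)) -> polybounded (dsize \o f) ->
  (exists2 w, polybounded w & forall b s, cost s (e b) <= w (s b)) ->
  polytime f.
Proof.
move=> ef fP [w wP we]; exists (fun b => Assign b (e b)), (fun x => w x + 1).
split=> //; first exact: polyboundedD (polybounded_const 1).
move=> b s; do 2!eexists; split; first exact: Exec_assign.
- by rewrite /update eqxx.
- by move=> v vb; rewrite /update ltn_eqF.
- by rewrite addn1 ltnS.
Qed.

Lemma polytime_id : polytime (fun x => x).
Proof.
apply: (@polytime_expr Var) => //; first exact: polybounded_dsize.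
by exists dsize => [|b s /=]; [exact: polybounded_dsize | rewrite addn0].
Qed.

Lemma polytime_const d : polytime (fun=> d).
Proof.
apply: (@polytime_expr (fun=> Quote d)) => //; first exact: polybounded_const.
exists (fun=> dsize d) => [|b s /=]; first exact: polybounded_const.
by rewrite addn0.
Qed.

Lemma polytime_hd f : polytime f -> polytime (fun x => dhd (f x)).
Proof.
apply: polytime_comp; apply: (@polytime_expr (fun b => Hd (Var b))) => //.
  by apply: (polybounded_le polybounded_dsize) => x; exact: dsize_hd.
exists (fun x => dsize x + dsize x) => [|b s /=].
  exact: polyboundedD polybounded_dsize polybounded_dsize.
by rewrite addn0 leq_add2r; exact: dsize_hd.
Qed.

Lemma polytime_tl f : polytime f -> polytime (fun x => dtl (f x)).
Proof.
apply: polytime_comp; apply: (@polytime_expr (fun b => Tl (Var b))) => //.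
  by apply: (polybounded_le polybounded_dsize) => x; exact: dsize_tl.
exists (fun x => dsize x + dsize x) => [|b s /=].
  exact: polyboundedD polybounded_dsize polybounded_dsize.
by rewrite addn0 leq_add2r; exact: dsize_tl.
Qed.

Lemma polytime_pair f g : polytime f -> polytime g ->
  polytime (fun x => Pair (f x) (g x)).
Proof.
move=> [cf [Tf [TfP fP cfP]]] [cg [Tg [TgP gP cgP]]].
(* [f] runs on a copy of the argument at [b.+1] and [g] on a copy at [b.+2]: the argument at [b]
   survives the first run, and the first result survives the second. *)
exists (fun b =>
  Seq (Seq (Seq (Assign b.+1 (Var b)) (cf b.+1))
           (Seq (Assign b.+2 (Var b)) (cg b.+2)))
      (Assign b (Defs.Cons (Var b.+1) (Var b.+2)))).
exists (fun x => (dsize x).*2 + Tf x + Tg x + (dsize (f x) + dsize (g x)).*2 + 4).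
have pfg : polybounded (fun x => dsize (f x) + dsize (g x)) by exact: polyboundedD.
have pD w : polybounded w -> polybounded (fun x => (w x).*2).
  by move=> wP; apply: (polybounded_le (polyboundedD wP wP)) => x; rewrite addnn.
split.
- apply: polyboundedD (polybounded_const 4); apply: polyboundedD (pD _ pfg).
  by apply: polyboundedD TgP; apply: polyboundedD TfP; apply: pD polybounded_dsize.
- by apply: polybounded_le (polyboundedD pfg (polybounded_const 1)) _ => x /=; lia.
move=> b s; pose s0 := update s b.+1 (s b).
have [s1 [n1 [e1 v1 k1 t1]]] := cfP b.+1 s0.
pose s2 := update s1 b.+2 (s1 b).
have [s3 [n3 [e3 v3 k3 t3]]] := cgP b.+2 s2.
have sb : s1 b = s b by rewrite k1 // /s0 /update ltn_eqF.
have s0b : s0 b.+1 = s b by rewrite /s0 /update eqxx.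
have s2b : s2 b.+2 = s b by rewrite /s2 /update eqxx.
have s3b : s3 b.+1 = f (s b) by rewrite k3 // /s2 /update ltn_eqF // v1 s0b.
do 2!eexists; split.
- apply: Exec_seq (Exec_assign _ _ _); apply: Exec_seq.
    by apply: Exec_seq e1; exact: Exec_assign.
  by apply: Exec_seq e3; exact: Exec_assign.
- by rewrite /update eqxx /= s3b v3 s2b.
- move=> v vb; rewrite /update ltn_eqF // k3; last by lia.
  rewrite /s2 /update ltn_eqF; last by lia.
  rewrite k1; last by lia.
  by rewrite /s0 /update ltn_eqF //; lia.
- rewrite /= s3b v3 s2b sb.
  by move: t1 t3; rewrite s0b s2b; lia.
Qed.

Lemma polytime_comp2 F f g :
  polytime (fun z => F (dhd z) (dtl z)) -> polytime f -> polytime g ->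
  polytime (fun x => F (f x) (g x)).
Proof. by move=> FP fP gP; have := polytime_comp FP (polytime_pair fP gP). Qed.

Lemma polytime_eq f g : polytime f -> polytime g ->
  polytime (fun x => deq (f x) (g x)).
Proof.
apply: (@polytime_comp2 deq).
apply: (@polytime_expr (fun b => Eq (Hd (Var b)) (Tl (Var b)))) => //.
  apply: (polybounded_le (polybounded_const 3)) => x /=.
  by rewrite /deq; case: data_eqb.
exists (fun x => 3 + 4 * dsize x) => [|b s /=].
  apply: polyboundedD; first exact: polybounded_const.
  by apply: polyboundedM polybounded_dsize; exact: polybounded_const.
have := dsize_hd (s b); have := dsize_tl (s b); rewrite /dhd /dtl.
by case: data_eqb => /=; lia.
Qed.

Lemma polytime_if f g h : polytime f -> polytime g -> polytime h ->
  polytime (fun x => dif (f x) (g x) (h x)).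
Proof.
move=> [cf [Tf [TfP fP cfP]]] [cg [Tg [TgP gP cgP]]] [ch [Th [ThP hP chP]]].
(* The test runs on a copy at [b.+1], so that either branch still finds the argument at [b]. *)
exists (fun b => Seq (Seq (Assign b.+1 (Var b)) (cf b.+1))
                     (If (Var b.+1) (cg b) (ch b))).
exists (fun x => dsize x + Tf x + Tg x + Th x + dsize (f x) + 2); split.
- apply: polyboundedD (polybounded_const 2); apply: polyboundedD fP.
  apply: polyboundedD ThP; apply: polyboundedD TgP.
  exact: polyboundedD polybounded_dsize TfP.
- apply: polybounded_le (polyboundedD gP hP) _ => x /=.
  by case: (f x) => [|? ?] /=; lia.
move=> b s; pose s0 := update s b.+1 (s b).
have [s1 [n1 [e1 v1 k1 t1]]] := cfP b.+1 s0.
have s0b : s0 b.+1 = s b by rewrite /s0 /update eqxx.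
have keep v : v < b.+1 -> s1 v = s v.
  by move=> vb; rewrite k1 // /s0 /update ltn_eqF.
have s1b : s1 b = s b by exact: keep.
have s1t : s1 b.+1 = f (s b) by rewrite v1 s0b.
have e01 : exec (Seq (Assign b.+1 (Var b)) (cf b.+1)) s s1 ((cost s (Var b)).+1 + n1).
  by apply: Exec_seq e1; exact: Exec_assign.
move: t1; rewrite s0b => t1.
case E : (f (s b)) => [|y z].
- have [s2 [n2 [e2 v2 k2 t2]]] := chP b s1.
  do 2!eexists; split.
  + by apply: (Exec_seq e01); apply: Exec_if_false e2; rewrite /= s1t.
  + by rewrite v2 s1b.
  + by move=> v vb; rewrite k2 // keep // ltnW.
  + by rewrite /= s1t E /=; rewrite s1b in t2; lia.
- have [s2 [n2 [e2 v2 k2 t2]]] := cgP b s1.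
  do 2!eexists; split.
  + by apply: (Exec_seq e01); apply: Exec_if_true e2; rewrite /= s1t E.
  + by rewrite v2 s1b.
  + by move=> v vb; rewrite k2 // keep // ltnW.
  + by rewrite /= s1t E /=; rewrite s1b in t2; lia.
Qed.

(** * Loops and folds *)

Fixpoint dwhile n (f : data -> data) z :=
  if n is m.+1 then if dhd z is Leaf then z else dwhile m f (f z) else z.

Lemma dwhile_halted n f z : dhd z = Leaf -> dwhile n f z = z.
Proof. by case: n => //= n ->. Qed.

Lemma dwhileD m n f z : dwhile (m + n) f z = dwhile n f (dwhile m f z).
Proof.
elim: m z => //= m IH z; case E : (dhd z) => //.
by rewrite dwhile_halted.
Qed.

(** A halted state is unchanged by further rounds. Hence a loop may be evaluated with any convenient
    number of rounds in place of the official bound. *)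
Lemma dwhile_unique m n f z :
  dhd (dwhile m f z) = Leaf -> dhd (dwhile n f z) = Leaf ->
  dwhile m f z = dwhile n f z.
Proof.
wlog mn : m n / m <= n => [H hm hn|hm _].
  by have [/H|/ltnW/H] := leqP m n; [apply | move->].
by rewrite -(subnKC mn) dwhileD [RHS]dwhile_halted.
Qed.

Lemma polytime_while f g (N w : data -> nat) :
  polytime f -> polytime g -> polybounded N -> polybounded w ->
  (forall x, dhd (dwhile (N x) f (g x)) = Leaf) ->
  (forall x i, dsize (dwhile i f (g x)) <= w x) ->
  polytime (fun x => dwhile (N x) f (g x)).
Proof.
move=> [c [T [[k Tk] fP cP]]] [cg [Tg [TgP gP cgP]]] NP wP halt le_w.
(* Cost of one round on a state of size at most [w x]: the body, the test, and the charge for the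
   loop itself. The successor of [N x] below pays for the last, failing test. *)
pose t x := k * w x ^ k + 2 * w x + 1.
exists (fun b => Seq (cg b) (While (Hd (Var b)) (c b))).
exists (fun x => Tg x + (N x).+1 * t x); split.
- apply: (polyboundedD TgP).
  apply: polybounded_le (polyboundedM (polyboundedD NP (polybounded_const 1))
    (polyboundedD (polyboundedD (polyboundedM (polybounded_const k) (polyboundedX k wP))
     (polyboundedM (polybounded_const 2) wP)) (polybounded_const 1))) _ => x.
  by rewrite addn1.
- by apply: (polybounded_le wP) => x; exact: le_w.
move=> b s; have [s0 [n0 [e0 v0 k0 t0]]] := cgP b s.
suff [s' [n [e1 v1 k1 t1]]] : exists s' n,
    [/\ exec (While (Hd (Var b)) (c b)) s0 s' n,
        s' b = dwhile (N (s b)) f (g (s b)),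
        forall v, v < b -> s' v = s0 v & n <= (N (s b)).+1 * t (s b)].
  exists s', (n0 + n); split => //; first exact: Exec_seq e0 e1.
  - by move=> v vb; rewrite k1 // k0.
  - exact: leq_add.
move: (halt (s b)) (le_w (s b)); rewrite /t -v0.
(* Both bounds refer to the original argument, so they are frozen as numbers before the induction
   changes the store. *)
move: (N (s b)) (w (s b)) => n W {v0 k0 t0 e0 s}.
have costE s : cost s (Hd (Var b)) <= 2 * dsize (s b).
  by have /= := dsize_hd (s b); rewrite /dhd; lia.
elim: n s0 => [|n IH] s.
  move=> hs leW; exists s, (cost s (Hd (Var b))).+1; split => //.
  - exact: Exec_while_false.
  - by have := leW 0; have := costE s; move=> /=; lia.
move=> hs leW; have sW := leW 0; rewrite /= in sW.
case E : (dhd (s b)) => [|y z].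
  exists s, (cost s (Hd (Var b))).+1; split => //.
  - exact: Exec_while_false.
  - by rewrite /= E.
  - by have := costE s; rewrite mulSn; lia.
have [s1 [n1 [e1 v1 k1 t1]]] := cP b s.
have hs1 : dhd (dwhile n f (s1 b)) = Leaf by move: hs; rewrite /= E v1.
have leW1 i : dsize (dwhile i f (s1 b)) <= W.
  by have := leW i.+1; rewrite /= E v1.
have [s2 [n2 [e2 v2 k2 t2]]] := IH s1 hs1 leW1.
do 2!eexists; split.
- by apply: Exec_while_true e1 e2; rewrite /= -/(dhd (s b)) E.
- by rewrite v2 v1 /= E.
- by move=> v vb; rewrite k2 // k1.
- have tW : T (s b) <= k * W ^ k.
    apply: leq_trans (Tk _) _; rewrite leq_mul //.
    by case: (k) => // k'; rewrite leq_exp2r.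
  by have := costE s; rewrite mulSn /=; lia.
Qed.

Fixpoint dfold (F : data -> data -> data) acc l :=
  if l is Pair e r then dfold F (F e acc) r else acc.

(** The fold is a loop whose state consists of the remaining list, the parameter [x] and the
    accumulator. The invariant [I] restricts the size bound to states that can be reached. *)
Lemma polytime_fold_invariant (F : data -> data -> data -> data) h g
    (I : data -> data -> data -> Prop) (w : data -> nat) :
  polytime (fun z => F (dhd z) (dhd (dtl z)) (dtl (dtl z))) ->
  polytime h -> polytime g -> polybounded w ->
  (forall x, I x (g x) (h x)) ->
  (forall x e r a, I x (Pair e r) a -> I x r (F x e a)) ->
  (forall x r a, I x r a -> dsize r + dsize a <= w x) ->
  polytime (fun x => dfold (F x) (h x) (g x)).
Proof.
move=> FP hP gP wP I0 IS Iw.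
pose step z := Pair (dtl (dhd z)) (Pair (dhd (dtl z))
  (F (dhd (dtl z)) (dhd (dhd z)) (dtl (dtl z)))).
pose init x := Pair (g x) (Pair x (h x)).
have stepP : polytime step.
  have P1 : polytime (fun z => dhd (dtl z)).
    by apply: polytime_hd; apply: polytime_tl; exact: polytime_id.
  have P2 : polytime (fun z => dhd (dhd z)).
    by do 2!apply: polytime_hd; exact: polytime_id.
  have P3 : polytime (fun z => dtl (dtl z)).
    by do 2!apply: polytime_tl; exact: polytime_id.
  apply: polytime_pair; first by apply: polytime_tl; apply: polytime_hd polytime_id.
  apply: polytime_pair => //.
  exact: (polytime_comp FP (polytime_pair P1 (polytime_pair P2 P3))).
have initP : polytime init.
  by apply: polytime_pair => //; apply: polytime_pair => //; exact: polytime_id.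
have run n x l a : dsize l <= n ->
    dwhile n step (Pair l (Pair x a)) = Pair Leaf (Pair x (dfold (F x) a l)).
  elim: n l a => [|n IH] l a; first by case: l.
  by case: l => [|e r] //= le_n; rewrite IH //=; lia.
have bound n x l a : I x l a ->
    dsize (dwhile n step (Pair l (Pair x a))) <= 2 + dsize x + w x.
  elim: n l a => [|n IH] l a Ia; first by have /= := Iw _ _ _ Ia; lia.
  case: l Ia => [|e r] Ia /=; first by have /= := Iw _ _ _ Ia; lia.
  exact: IH (IS _ _ _ _ Ia).
have loopP : polytime (fun x => dwhile (dsize (g x)) step (init x)).
  apply: (@polytime_while step init _ (fun x => 2 + dsize x + w x)) => //.
  - exact: polytime_dsize gP.
  - apply: polyboundedD wP; apply: polyboundedD polybounded_dsize.
    exact: polybounded_const.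
  - by move=> x; rewrite run.
  - by move=> x i; exact: bound.
apply: (eq_polytime (polytime_tl (polytime_tl loopP))) => x.
by rewrite run.
Qed.

(** The potential [dsize a + dsize r * (w x).+1] of accumulator and remaining list never increases:
    consuming [e] frees [(dsize e).+1 * (w x).+1], which pays for the growth of the accumulator. *)
Lemma polytime_fold (F : data -> data -> data -> data) h g (w : data -> nat) :
  polytime (fun z => F (dhd z) (dhd (dtl z)) (dtl (dtl z))) ->
  polytime h -> polytime g -> polybounded w ->
  (forall x e a, dsize (F x e a) <= dsize a + (dsize e).+1 * w x) ->
  polytime (fun x => dfold (F x) (h x) (g x)).
Proof.
move=> FP hP gP wP Fw.
apply: (polytime_fold_invariant FP hP gP
  (I := fun x r a => dsize a + dsize r * (w x).+1 <= dsize (h x) + dsize (g x) * (w x).+1)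
  (w := fun x => dsize (h x) + dsize (g x) * (w x).+1)).
- apply: polyboundedD (polytime_dsize hP) _.
  apply: polyboundedM (polytime_dsize gP) _.
  by apply: (polybounded_le (polyboundedD wP (polybounded_const 1))) => x; lia.
- by [].
- by move=> x e r a /=; have := Fw x e a; lia.
- by move=> x r a; lia.
Qed.

(** * Worklists *)

Definition worklist_step (c0 c1 : data -> data) (em : data -> data -> data) z :=
  dif (dhd (dhd z))
    (Pair (Pair (c0 (dhd (dhd z))) (Pair (c1 (dhd (dhd z))) (dtl (dhd z))))
          (em (dhd (dhd z)) (dtl z)))
    (Pair (dtl (dhd z)) (dtl z)).

(** The state pairs a stack of items with an output. An item other than [Leaf] is replaced by its
    images under [c0] and [c1] and contributes to the output through [em]; a [Leaf] is dropped. The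
    number of rounds comes from the bound on [weight] below. *)
Definition worklist c0 c1 em z :=
  dtl (dwhile (2 * dsize (dhd z)) (worklist_step c0 c1 em) z).

Section Worklist.

Variables (c0 c1 : data -> data) (em : data -> data -> data) (K : nat).
Hypothesis c_size : forall x y, dsize (c0 (Pair x y)) + dsize (c1 (Pair x y)) <= dsize (Pair x y).
Hypothesis em_size : forall x a, dsize (em x a) <= dsize a + K * dsize x.

Let step := worklist_step c0 c1 em.

(* Replacing an item by two items of the same total size decreases this
   weight, though not the size of the stack. *)
Fixpoint weight stack := if stack is Pair x r then (2 * dsize x).-1 + weight r else 0.

Lemma weight_le stack : weight stack <= 2 * dsize stack.
Proof. by elim: stack => //= x _ r IH; lia. Qed.

Lemma dsize_weight stack : dsize stack <= 1 + 2 * weight stack.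
Proof. by elim: stack => //= x _ r IH; have := dsize_gt0 x; lia. Qed.

(** An item of size n weighs 2n - 1, while its two parts together weigh at most 2n - 2, as 1 is
    subtracted for each of them. A dropped [Leaf] weighs 1. *)
Lemma worklist_weight x r a : weight (dhd (step (Pair (Pair x r) a))) < weight (Pair x r).
Proof.
case: x => [|x y] /=; first by lia.
have := c_size x y; have := dsize_gt0 (c0 (Pair x y)).
by have := dsize_gt0 (c1 (Pair x y)) => /=; lia.
Qed.

Lemma worklist_halt n z : weight (dhd z) <= n -> dhd (dwhile n step z) = Leaf.
Proof.
elim: n z => [|n IH] z.
  by case: (dhd z) => //= x r; have := dsize_gt0 x; lia.
rewrite [dwhile _ _ _]/=; case E : (dhd z) => [|x r] // le_n; apply: IH.
case: z E => [|y a] //= E; move: le_n; rewrite E.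
by have := worklist_weight x r a; rewrite /=; lia.
Qed.

(** Each round lowers the weight and adds at most [K * M] to the output, since an item is no larger
    than the weight of the stack. [M] stays fixed while the weight falls. *)
Lemma worklist_dsize M i z : weight (dhd z) <= M ->
  dsize (dwhile i step z) <=
    2 + 2 * weight (dhd z) + dsize (dtl z) + weight (dhd z) * (K * M).
Proof.
have base y : dsize y <= 2 + 2 * weight (dhd y) + dsize (dtl y) + weight (dhd y) * (K * M).
  by case: y => [|s a] //=; have := dsize_weight s; lia.
elim: i z => [|i IH] z le_M; first exact: base.
rewrite [dwhile _ _ _]/=; case E : (dhd z) => [|x r]; first by rewrite -E; exact: base.
case: z E le_M => [|y a] //= -> le_M.
have lt := worklist_weight x r a.
apply: leq_trans (IH _ (leq_trans (ltnW lt) le_M)) _.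
have aK : dsize (dtl (step (Pair (Pair x r) a))) <= dsize a + K * M.
  case: x lt le_M => [|x0 x1] lt le_M /=; first by lia.
  apply: leq_trans (em_size _ _) _; rewrite leq_add2l leq_mul2l.
  by apply/orP; right; move: le_M => /=; lia.
move: lt; set w' := weight (dhd _); rewrite [weight (Pair x r)]/=; set w := _ + weight r => lt.
by have : w' * (K * M) + K * M <= w * (K * M); [rewrite -mulSnr leq_mul2r lt orbT | lia].
Qed.

Lemma polytime_worklist :
  polytime c0 -> polytime c1 -> polytime (fun z => em (dhd z) (dtl z)) ->
  polytime (worklist c0 c1 em).
Proof.
move=> c0P c1P emP; apply: polytime_tl.
pose W x := 2 * dsize x.
have WP : polybounded W by apply: polyboundedM (polybounded_const 2) polybounded_dsize.
have headP : polytime (fun z => dhd (dhd z)) by do 2!apply: polytime_hd; exact: polytime_id.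
have restP : polytime (fun z => dtl (dhd z)).
  by apply: polytime_tl; apply: polytime_hd; exact: polytime_id.
have outP : polytime dtl by apply: polytime_tl polytime_id.
apply: (polytime_while (w := fun x => 2 + 2 * W x + dsize x + W x * (K * W x))).
- apply: (polytime_if headP); apply: polytime_pair => //.
    apply: polytime_pair; first exact: polytime_comp c0P headP.
    by apply: polytime_pair => //; exact: polytime_comp c1P headP.
  exact: (polytime_comp2 (F := em) emP headP outP).
- exact: polytime_id.
- apply: (polybounded_le WP) => x; rewrite /W; have := dsize_hd x; lia.
- apply: polyboundedD; last first.
    exact: polyboundedM WP (polyboundedM (polybounded_const K) WP).
  apply: polyboundedD polybounded_dsize.
  apply: polyboundedD (polybounded_const 2) _.
  exact: polyboundedM (polybounded_const 2) WP.
- by move=> x; apply: worklist_halt; exact: weight_le.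
- move=> x i.
  have wW : weight (dhd x) <= W x.
    by apply: leq_trans (weight_le _) _; have := dsize_hd x; rewrite /W; lia.
  apply: leq_trans (worklist_dsize i wW) _.
  have := dsize_tl x.
  by have : weight (dhd x) * (K * W x) <= W x * (K * W x); [rewrite leq_mul2r wW orbT | lia].
Qed.

Lemma worklistE m z a : dwhile m step z = Pair Leaf a -> worklist c0 c1 em z = a.
Proof.
move=> E; rewrite /worklist -(@dwhile_unique m) ?E //.
exact/worklist_halt/weight_le.
Qed.

End Worklist.

Ltac solve_polytime :=
  repeat first [ assumption | apply: polytime_id | apply: polytime_const
               | apply: polytime_pair | apply: polytime_if | apply: polytime_eq
               | apply: polytime_hd | apply: polytime_tl ].

(** * The algorithm *)

Lemma dfold_dsize F a l :
  (forall e b, dsize (F e b) <= dsize b + (dsize e).+1) ->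
  dsize (dfold F a l) <= dsize a + dsize l.
Proof.
move=> Fw; elim: l a => [|e _ r IH] a /=; first by rewrite leq_addr.
by apply: leq_trans (IH _) _; have := Fw e a; lia.
Qed.

Definition dhas p l := dfold (fun e a => dif (p e) (of_bool true) a) Leaf l.

Definition dall p l :=
  dif (dhas (fun e => dif (p e) Leaf (of_bool true)) l) Leaf (of_bool true).

Lemma polytime_has (p : data -> data -> data) g :
  polytime (fun z => p (dhd z) (dtl z)) -> polytime g ->
  polytime (fun x => dhas (p x) (g x)).
Proof.
move=> pP gP.
apply: (polytime_fold (F := fun x e a => dif (p x e) (of_bool true) a) (w := fun=> 1)) => //.
- apply: polytime_if; last 2 first; [by solve_polytime | by solve_polytime |].
  by apply: (polytime_comp2 pP); solve_polytime.
- exact: polytime_const.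
- exact: polybounded_const.
- by move=> x e a; have := dsize_gt0 e; have := dsize_gt0 a; case: (p x e) => [|? ?] /=; lia.
Qed.

Lemma polytime_all (p : data -> data -> data) g :
  polytime (fun z => p (dhd z) (dtl z)) -> polytime g ->
  polytime (fun x => dall (p x) (g x)).
Proof.
move=> pP gP; apply: polytime_if; try by solve_polytime.
by apply: (polytime_has (p := fun x e => dif (p x e) Leaf (of_bool true))) => //; solve_polytime.
Qed.

(** The set X is not stored by itself: its elements are the succedents in the log [L]. *)
Definition succ_in a L := dhas (fun s => deq a (dtl s)) L.

Lemma polytime_succ_in f g : polytime f -> polytime g ->
  polytime (fun x => succ_in (f x) (g x)).
Proof.
move=> fP gP; apply: (polytime_has (p := fun x s => deq (f x) (dtl s))) => //.
have := polytime_comp fP (polytime_hd polytime_id).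
by move=> ?; solve_polytime.
Qed.

Definition dfire s L := dif (dall (fun a => succ_in a L) (dhd s)) (Pair s L) L.

Definition dpass S L := dfold dfire L S.

(** The outer fold uses [S] only as a counter, making one pass for each of its elements. *)
Definition dsaturate S L := dfold (fun=> dpass S) L S.

Lemma dsize_fire s L : dsize (dfire s L) <= dsize L + (dsize s).+1.
Proof. by rewrite /dfire; case: dall => [|? ?] /=; lia. Qed.

Lemma polytime_fire f g : polytime f -> polytime g ->
  polytime (fun x => dfire (f x) (g x)).
Proof.
move=> fP gP; apply: polytime_if; try by solve_polytime.
apply: (polytime_all (p := fun x a => succ_in a (g x))); last by solve_polytime.
apply: polytime_succ_in; first by solve_polytime.
by apply: (polytime_comp gP); solve_polytime.
Qed.

Lemma polytime_pass f g : polytime f -> polytime g ->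
  polytime (fun x => dpass (f x) (g x)).
Proof.
move=> fP gP; apply: (polytime_fold (F := fun=> dfire) (w := fun=> 1)) => //.
- by apply: polytime_fire; solve_polytime.
- exact: polybounded_const.
- by move=> _ s L; rewrite muln1; exact: dsize_fire.
Qed.

Lemma polytime_saturate f g : polytime f -> polytime g ->
  polytime (fun x => dsaturate (f x) (g x)).
Proof.
move=> fP gP.
apply: (polytime_fold (F := fun x _ => dpass (f x)) (w := fun x => dsize (f x))) => //.
- by apply: polytime_pass; [apply: (polytime_comp fP)|]; solve_polytime.
- exact: polytime_dsize fP.
- move=> x e a; apply: leq_trans (dfold_dsize a (f x) dsize_fire) _.
  by rewrite mulSn; lia.
Qed.

Definition dremcat b l m := dfold (fun a r => dif (deq b a) r (Pair a r)) m l.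

Lemma polytime_remcat f g h : polytime f -> polytime g -> polytime h ->
  polytime (fun x => dremcat (f x) (g x) (h x)).
Proof.
move=> fP gP hP.
apply: (polytime_fold (F := fun x a r => dif (deq (f x) a) r (Pair a r)) (w := fun=> 1)) => //.
- by have := polytime_comp fP (polytime_hd polytime_id) => ?; solve_polytime.
- exact: polybounded_const.
- by move=> x a r; case: deq => [|? ?] /=; lia.
Qed.

Lemma dsize_remcat b l m : dsize (dremcat b l m) <= dsize m + dsize l.
Proof. by apply: dfold_dsize => // a r; case: deq => [|? ?] /=; lia. Qed.

(** [Leaf] in place of [e] means that no deduction has been started; the first sequent met with
    succedent [t] starts one. Afterwards [dhd (dhd e)] is the antecedent at the root of [e]. *)
Definition dcut t s e :=
  dif e
    (dif (dhas (deq (dtl s)) (dhd (dhd e)))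
       (Pair (Pair (dremcat (dtl s) (dhd (dhd e)) (dhd s)) t)
             (data_of_seq [:: Pair s Leaf; e]))
       e)
    (dif (deq t (dtl s)) (Pair s Leaf) Leaf).

Definition dcuts t L := dfold (dcut t) Leaf L.

Lemma polytime_cuts f g : polytime f -> polytime g ->
  polytime (fun x => dcuts (f x) (g x)).
Proof.
move=> fP gP.
(* A cut copies the antecedent out of the accumulator, so [polytime_fold] does not apply. The
   invariant bounds the antecedent together with the remaining log by the whole log; hence each step
   adds at most [C x]. *)
pose C x := 3 * dsize (g x) + dsize (f x) + 10.
pose I x r e := dsize (dhd (dhd e)) + dsize r <= 1 + dsize (g x) /\
  dsize e + dsize r * C x <= 1 + dsize (g x) * C x.
apply: (polytime_fold_invariant (F := fun x => dcut (f x)) (I := I)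
  (w := fun x => 2 + dsize (g x) + dsize (g x) * C x)) => //.
- have := polytime_comp fP (polytime_hd polytime_id) => fhP.
  have sP : polytime (fun z => dhd (dtl z)) by solve_polytime.
  have eP : polytime (fun z => dtl (dtl z)) by solve_polytime.
  apply: polytime_if => //; last by solve_polytime.
  apply: polytime_if => //; last first.
    apply: polytime_pair; last by rewrite /=; solve_polytime.
    by apply: polytime_pair => //; apply: polytime_remcat; solve_polytime.
  apply: (polytime_has (p := fun z => deq (dtl (dhd (dtl z))))); last by solve_polytime.
  by solve_polytime.
- by solve_polytime.
- have GP := polytime_dsize gP; have TP := polytime_dsize fP.
  have CP : polybounded C.
    apply: polyboundedD (polybounded_const 10); apply: polyboundedD TP.
    exact: polyboundedM (polybounded_const 3) GP.
  apply: polyboundedD (polyboundedM GP CP).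
  exact: polyboundedD (polybounded_const 2) GP.
- move=> x s r e; rewrite /I.
  have : C x = 3 * dsize (g x) + dsize (f x) + 10 by [].
  move: (C x) => c cE; rewrite /= mulSn mulnDl => -[le1 le2].
  have hs := dsize_hd s; have s0 := dsize_gt0 s; have r0 := dsize_gt0 r.
  case E : e => [|e0 e1].
    have : c <= dsize s * c by rewrite leq_pmull.
    by rewrite E /= in le1 le2 *; case: deq => [|? ?] /=; split; lia.
  rewrite -E in le1 le2 *; rewrite {}/dcut; set e' := dif _ _ e.
  have -> : dif e e' (dif (deq (f x) (dtl s)) (Pair s Leaf) Leaf) = e' by rewrite E.
  rewrite {}/e'.
  case: dhas => [|? ?] /=; first by split; lia.
  have := dsize_remcat (dtl s) (dhd (dhd e)) (dhd s).
  by split; lia.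
- move=> x r e []; move: (_ * C x) (_ * C x) => p q; lia.
Qed.

(** On derivations the items are lists of trees: a list is split into the premises of its first tree
    and the remaining trees, and the root of the first tree is emitted. *)
Definition forest_c0 x := dtl (dhd x).
Definition forest_emit x a := Pair (dhd (dhd x)) a.
Definition dsequents := worklist forest_c0 dtl forest_emit.

(** Here the items are formulas, and 3 and 4 are the tags of [And] and [Imp]. As in [Cseq], only the
    conclusion of an implication is pursued, and disjunctions are not entered. *)
Definition form_c0 x := dif (deq (dhd x) (numeral 3)) (dhd (dtl x)) Leaf.
Definition form_c1 x :=
  dif (deq (dhd x) (numeral 3)) (dtl (dtl x))
    (dif (deq (dhd x) (numeral 4)) (dtl (dtl x)) Leaf).
Definition form_emit x a :=
  dif (deq (dhd x) (numeral 3))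
    (Pair (Pair (data_of_seq [:: x]) (dhd (dtl x)))
      (Pair (Pair (data_of_seq [:: x]) (dtl (dtl x))) a))
    (dif (deq (dhd x) (numeral 4))
      (Pair (Pair (data_of_seq [:: dhd (dtl x); x]) (dtl (dtl x))) a) a).
Definition dCseqs := worklist form_c0 form_c1 form_emit.

(** The inner worklist starts with the one-tree list containing [x]. Its output is the initial
    output of the outer one, whose stack is the antecedent at the root. *)
Definition dpremises x :=
  dCseqs (Pair (dhd (dhd x)) (dsequents (Pair (data_of_seq [:: data_of_seq [:: x]]) Leaf))).

Definition dhyps G := dfold (fun a r => Pair (Pair G a) r) Leaf G.

Definition dlog x := dsaturate (dpremises x) (dhyps (dhd (dhd x))).

(** The paths [dhd (dtl (dtl (dhd x)))] and [dtl (dtl (dtl (dhd x)))] lead to the two disjuncts of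
    the root. The second disjunct is preferred if both are in X. *)
Definition dmain x :=
  let i := succ_in (dtl (dtl (dtl (dhd x)))) (dlog x) in
  Pair i (dcuts (dif i (dtl (dtl (dtl (dhd x)))) (dhd (dtl (dtl (dhd x))))) (dlog x)).

Lemma forest_size x y :
  dsize (forest_c0 (Pair x y)) + dsize (dtl (Pair x y)) <= dsize (Pair x y).
Proof. by rewrite /forest_c0 /=; have := dsize_tl x; lia. Qed.

Lemma forest_emit_size x a : dsize (forest_emit x a) <= dsize a + 2 * dsize x.
Proof.
rewrite /forest_emit /=; have := dsize_gt0 x; have := dsize_hd x; have := dsize_hd (dhd x); lia.
Qed.

Lemma form_size x y :
  dsize (form_c0 (Pair x y)) + dsize (form_c1 (Pair x y)) <= dsize (Pair x y).
Proof.
rewrite /form_c0 /form_c1 /=; have := dsize_gt0 x.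
by case: deq; case: deq; case: y => /=; lia.
Qed.

Lemma form_emit_size x a : dsize (form_emit x a) <= dsize a + 12 * dsize x.
Proof.
rewrite /form_emit; have := dsize_gt0 x; have := dsize_tl x; have := dsize_hd (dtl x).
by have := dsize_tl (dtl x); case: deq => [|? ?]; case: deq => [|? ?] /=; lia.
Qed.

Lemma polytime_main : polytime dmain.
Proof.
have sP f : polytime f -> polytime (fun x => dsequents (f x)).
  apply: polytime_comp; apply: (polytime_worklist forest_size forest_emit_size); by solve_polytime.
have cP f : polytime f -> polytime (fun x => dCseqs (f x)).
  by apply: polytime_comp; apply: (polytime_worklist form_size form_emit_size); solve_polytime.
have hP : polytime (fun x => dhyps (dhd (dhd x))).
  apply: (polytime_comp (f := dhyps)); last by solve_polytime.
  apply: (polytime_fold (F := fun G a r => Pair (Pair G a) r) (w := fun G => dsize G + 2)).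
  - by solve_polytime.
  - by solve_polytime.
  - by solve_polytime.
  - exact: polyboundedD polybounded_dsize (polybounded_const 2).
  - by move=> x e a /=; lia.
have pP : polytime dpremises.
  by apply: cP; apply: polytime_pair; [solve_polytime | apply: sP; solve_polytime].
have lP : polytime dlog by exact: polytime_saturate.
have iP : polytime (fun x => succ_in (dtl (dtl (dtl (dhd x)))) (dlog x)).
  by apply: polytime_succ_in => //; solve_polytime.
by apply: polytime_pair => //; apply: polytime_cuts => //; solve_polytime.
Qed.

(** * Correctness of forward chaining *)

Lemma data_of_seq_inj : injective data_of_seq.
Proof. by elim=> [|x l IH] [|y m] //= [-> /IH ->]. Qed.

Lemma form_code_inj : injective form_code.
Proof.
elim=> [p||a0 IH0 a1 IH1|a0 IH0 a1 IH1|a0 IH0 a1 IH1]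
  [q||b0 b1|b0 b1|b0 b1] //= []; last 3 first.
- by move=> /IH0 -> /IH1 ->.
- by move=> /IH0 -> /IH1 ->.
- by move=> /IH0 -> /IH1 ->.
have of_bool_inj : injective of_bool by case=> [] [].
by move/data_of_seq_inj/(inj_map of_bool_inj) ->.
Qed.

Lemma deq_form a b : deq (form_code a) (form_code b) = of_bool (a == b).
Proof.
rewrite /deq; congr of_bool.
by apply/data_eqbP/eqP => [/form_code_inj|->].
Qed.

(* Codes list a cedent in some order; [lseq] keeps that list. *)
Notation lseq := (seq form * form)%type.

Definition forms_code (l : seq form) := data_of_seq (map form_code l).
Definition lseq_code (s : lseq) := Pair (forms_code s.1) (form_code s.2).
Definition lseqs_code (L : seq lseq) := data_of_seq (map lseq_code L).
Definition seq_of (s : lseq) : sequent := ([fset a in s.1], s.2).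

Lemma dfold_map T F (enc : T -> data) a l :
  dfold F a (data_of_seq (map enc l)) = foldl (fun a e => F (enc e) a) a l.
Proof. by elim: l a => //= e l IH a; rewrite IH. Qed.

Lemma dhas_map T (enc : T -> data) p (P : pred T) l :
  (forall e, p (enc e) = of_bool (P e)) ->
  dhas p (data_of_seq (map enc l)) = of_bool (has P l).
Proof.
move=> pP; rewrite /dhas dfold_map.
suff E b : foldl (fun a e => dif (p (enc e)) (of_bool true) a) (of_bool b) l
    = of_bool (b || has P l) by exact: (E false).
elim: l b => [|e l IH] b /=; first by rewrite orbF.
by rewrite pP dif_bool orbA -IH; case: (P e); case: b.
Qed.

Lemma dall_map T (enc : T -> data) p (P : pred T) l :
  (forall e, p (enc e) = of_bool (P e)) ->
  dall p (data_of_seq (map enc l)) = of_bool (all P l).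
Proof.
move=> pP; rewrite /dall (dhas_map (P := predC P)).
  by rewrite dif_bool has_predC; case: all.
by move=> e; rewrite pP /=; case: (P e).
Qed.

Lemma succ_in_code a L :
  succ_in (form_code a) (lseqs_code L) = of_bool (a \in map snd L).
Proof.
rewrite /succ_in (dhas_map (P := fun s => a == s.2)) => [|s]; last exact: deq_form.
congr of_bool; elim: L => //= s L ->.
by rewrite inE.
Qed.

Definition fire s (L : seq lseq) := if all (mem (map snd L)) s.1 then s :: L else L.
Definition pass (S L : seq lseq) := foldl (fun L s => fire s L) L S.
Definition saturate (S L : seq lseq) := foldl (fun L _ => pass S L) L S.

Lemma dfire_code s L : dfire (lseq_code s) (lseqs_code L) = lseqs_code (fire s L).
Proof.
rewrite /dfire /= (dall_map (P := mem (map snd L))); last by move=> a; exact: succ_in_code.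
by rewrite dif_bool /fire; case: ifP.
Qed.

Lemma dpass_code S L : dpass (lseqs_code S) (lseqs_code L) = lseqs_code (pass S L).
Proof.
rewrite /dpass dfold_map /pass.
by elim: S L => //= s S IH L; rewrite dfire_code IH.
Qed.

Lemma dsaturate_code S L :
  dsaturate (lseqs_code S) (lseqs_code L) = lseqs_code (saturate S L).
Proof.
rewrite /dsaturate dfold_map /saturate.
by elim: {2 4}S L => //= s S' IH L; rewrite dpass_code IH.
Qed.

Lemma fire_sub s (L : seq lseq) : {subset L <= fire s L}.
Proof. by rewrite /fire; case: ifP => _ t tL //; rewrite inE tL orbT. Qed.

Lemma pass_sub S L : {subset L <= pass S L}.
Proof.
rewrite /pass; elim: S L => [|s S IH] L t tL //=.
exact/IH/fire_sub.
Qed.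

Lemma sub_snd (L L' : seq lseq) :
  {subset L <= L'} -> {subset map snd L <= map snd L'}.
Proof. by move=> sub _ /mapP [s sL ->]; apply: map_f; exact: sub. Qed.

Definition closed_under (S : seq lseq) (X : seq form) :=
  all (fun s => all (mem X) s.1 ==> (s.2 \in X)) S.

(** The log only grows during a pass, so a sequent enabled at the start is still enabled when its
    turn comes. *)
Lemma pass_fires S L s :
  s \in S -> all (mem (map snd L)) s.1 -> s.2 \in map snd (pass S L).
Proof.
elim: S L => //= t S IH L; rewrite inE => /predU1P [->|sS] sL.
  rewrite -/(pass S (fire t L)).
  apply: (sub_snd (@pass_sub S (fire t L))).
  by rewrite /fire sL map_cons inE eqxx.
apply: IH => //; apply/allP => a /(allP sL).
exact: sub_snd (@fire_sub t L) _.
Qed.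

(** Sequents may fire again and lengthen the log, but they contribute no new succedent. *)
Lemma pass_closed S L : closed_under S (map snd L) ->
  map snd (pass S L) =i map snd L.
Proof.
move=> /allP clS; rewrite /pass.
have: {subset S <= S} by [].
elim: {2 4}S L clS => [|s T IH] L clS sub a //=.
have sS : s \in S by apply: sub; rewrite inE eqxx.
have fireE : map snd (fire s L) =i map snd L.
  rewrite /fire; case: ifP => // fs b; rewrite map_cons inE.
  case: eqP => //= ->; apply/esym; by have /implyP := clS _ sS; apply.
have subT : {subset T <= S} by move=> t tT; apply: sub; rewrite inE tT orbT.
rewrite (IH _ _ subT) => [|t tS]; first exact: fireE.
by rewrite (eq_all fireE) fireE; exact: clS.
Qed.

Lemma count_lt T (p q : pred T) s :
  subpred p q -> has (predD q p) s -> count p s < count q s.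
Proof.
move=> pq; elim: s => //= x s IH /orP [/andP [/= npx ->]|/IH]; last first.
  by have := pq x; case: (p x) => [->|_] //; lia.
by rewrite (negbTE npx) add0n add1n ltnS sub_count.
Qed.

(** As long as X is not closed, each pass increases the number of sequents in [S] with succedent in
    X. After [size S] passes either X is closed or all these succedents are in X. *)
Lemma saturate_closed S L : closed_under S (map snd (saturate S L)).
Proof.
have -> : saturate S L = iter (size S) (pass S) L.
  rewrite /saturate; elim: {2 3}S L => //= s T IH L.
  by rewrite IH -iterSr.
pose fired (L : seq lseq) := count (fun s : lseq => s.2 \in map snd L) S.
have step L' : closed_under S (map snd L') \/ fired L' < fired (pass S L').
  have [|/allPn [s sS]] := boolP (closed_under S (map snd L')); first by left.
  rewrite negb_imply => /andP [sL nsL]; right.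
  have sub (t : lseq) : t.2 \in map snd L' -> t.2 \in map snd (pass S L').
    by apply: sub_snd; exact: pass_sub.
  apply: count_lt => //; apply/hasP; exists s => //=.
  by rewrite nsL (pass_fires sS sL).
have [//|full] : closed_under S (map snd (iter (size S) (pass S) L)) \/
    size S <= fired (iter (size S) (pass S) L).
  elim: (size S) => [|n [IH|IH]]; [by right | left | ].
    rewrite iterS /closed_under.
    by under eq_all => s do rewrite (eq_all (pass_closed IH)) (pass_closed IH).
  have [IH'|lt] := step (iter n (pass S) L); last by right; exact: leq_ltn_trans lt.
  left; rewrite iterS /closed_under.
  by under eq_all => s do rewrite (eq_all (pass_closed IH')) (pass_closed IH').
apply/allP => s sS; apply/implyP => _.
have : fired (iter (size S) (pass S) L) == size S by rewrite eqn_leq full count_size.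
by rewrite -all_count => /allP; apply.
Qed.

Lemma saturate_ind S (Q : seq lseq -> Prop) L :
  (forall s L, s \in S -> Q L -> Q (fire s L)) -> Q L -> Q (saturate S L).
Proof.
move=> Qfire; have Qpass L' : Q L' -> Q (pass S L').
  have: {subset S <= S} by [].
  rewrite /pass; elim: {1 3}S L' => //= s T IH L' sub QL'.
  apply: IH; last by apply: Qfire => //; apply: sub; rewrite inE eqxx.
  by move=> t tT; apply: sub; rewrite inE tT orbT.
rewrite /saturate; elim: {2}S L => //= s T IH L' QL'.
exact/IH/Qpass.
Qed.

(** The latest entry comes first. Formulas of [G] need no derivation, which makes the initial
    entries valid. *)
Fixpoint valid_log (G : seq form) (L : seq lseq) :=
  if L is s :: r then all (fun a => (a \in G) || (a \in map snd r)) s.1 && valid_log G r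
  else true.

Lemma saturate_valid G S L : valid_log G L -> valid_log G (saturate S L).
Proof.
move=> vL; apply: (saturate_ind (Q := valid_log G)) => // s {vL}L _ vL.
rewrite /fire; case: ifP => //= /allP sL; rewrite vL andbT.
by apply/allP => a /sL /= ->; rewrite orbT.
Qed.

Lemma saturate_mem S L : {subset saturate S L <= S ++ L}.
Proof.
apply: (saturate_ind (Q := fun L' => {subset L' <= S ++ L})) => [s L' sS sub|s sL].
  rewrite /fire; case: ifP => // _ t; rewrite inE => /predU1P [->|/sub //].
  by rewrite mem_cat sS.
by rewrite mem_cat sL orbT.
Qed.

Lemma saturate_sub S L : {subset L <= saturate S L}.
Proof.
apply: (saturate_ind (Q := fun L' => {subset L <= L'})) => // s L' _ sub t tL.
exact/fire_sub/sub.
Qed.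

Lemma dremcat_code b l m :
  exists2 n, dremcat (form_code b) (forms_code l) (forms_code m) = forms_code n
    & n =i [predU mem m & [predD1 mem l & b]].
Proof.
rewrite /dremcat dfold_map; elim: l m => [|a l IH] m /=.
  by exists m => // c; rewrite !inE andbF orbF.
rewrite deq_form dif_bool; case: eqP => [<-|/eqP ba].
  have [n -> nE] := IH m; exists n => // c.
  by rewrite nE !inE; case: eqP.
have [n -> nE] := IH (a :: m); exists n => // c.
rewrite nE !inE; case: (eqVneq c a) => [->|] //=.
by rewrite eq_sym ba orbT.
Qed.

Lemma sequent_code_lseq s : sequent_code (seq_of s) (lseq_code s).
Proof.
exists (forms_code s.1) => //; exists s.1 => // a.
by rewrite !inE.
Qed.

(** * Reading off the deduction *)

Section Cuts.

Variables (S : {fset sequent}) (G : seq form) (t : form).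

(* [e] codes a cut-deduction of [t] from formulas in [G] and formulas that the
   remaining log [L] derives. *)
Definition cut_state (L : seq lseq) (x : data) :=
  exists l e y, [/\ x = Pair (lseq_code (l, t)) y, tree_code e x,
    cut_deduction S (seq_of (l, t)) e
    & {subset l <= [predU mem G & mem (map snd L)]}].

Lemma dcut_state s L x : seq_of s \in S -> valid_log G (s :: L) ->
  cut_state (s :: L) x -> cut_state L (dcut (form_code t) (lseq_code s) x).
Proof.
move=> sS /andP [/allP sL _] [l [e [y [-> eP cutP lL]]]].
rewrite /dcut [dhd (Pair _ _)]/= [dtl (lseq_code s)]/= [dhd (lseq_code _)]/=.
rewrite (dhas_map (P := pred1 s.2)) => [|a]; last by rewrite deq_form eq_sym.
rewrite [dif (Pair _ _) _ _]/= dif_bool has_pred1; case: ifPn => sl; last first.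
  exists l, e, y; split=> // a al.
  have := lL a al; rewrite !inE /=; case: eqP => // aE.
  by rewrite -aE al in sl.
have [n nE nP] := dremcat_code s.2 l s.1.
rewrite nE.
(* The cut formula is removed from the right antecedent only; it stays if it also belongs to
   [s.1]. *)
have defn : seq_of (n, t) = ([fset a in s.1] `|` ([fset a in l] `\ s.2), t).
  congr (_, _); apply/fsetP => a.
  by rewrite !inE nP !inE.
exists n, (Node (seq_of (n, t)) [:: Node (seq_of s) [::]; e]).
exists (data_of_seq [:: Pair (lseq_code s) Leaf; Pair (lseq_code (l, t)) y]).
split => //.
- apply: Tree_code; first exact: sequent_code_lseq.
  apply: Trees_code_cons.
    by apply: Tree_code (sequent_code_lseq _) _; exact: Trees_code_nil.
  by apply: Trees_code_cons => //; exact: Trees_code_nil.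
- rewrite defn; apply: (@Cut_cut _ _ _ _ s.2).
    exact: (Cut_leaf sS).
  by rewrite fsetD1K // !inE.
- move=> a; rewrite nP !inE.
  case/orP => [/sL //|/andP [/negbTE aE al]].
  by have := lL a al; rewrite !inE /= aE.
Qed.

(** The accumulator is [Leaf] until an entry with succedent [t] appears; from then on [cut_state] is
    maintained. With the log used up, the antecedent lies within [G]. *)
Lemma dcuts_state L : {subset map seq_of L <= S} -> valid_log G L ->
  t \in map snd L -> cut_state [::] (dcuts (form_code t) (lseqs_code L)).
Proof.
rewrite /dcuts dfold_map; set F := fun e s => _ => LS vL tL.
have F0 s : F Leaf s = if t == s.2 then Pair (lseq_code s) Leaf else Leaf.
  by rewrite /F /dcut /= deq_form dif_bool.
have FE x s : F x s = dcut (form_code t) (lseq_code s) x by [].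
move: F FE F0 => F FE F0.
have sub (s : lseq) (r : seq lseq) : {subset map seq_of (s :: r) <= S} ->
    seq_of s \in S /\ {subset map seq_of r <= S}.
  move=> srS; split; first by apply: srS; rewrite inE eqxx.
  by move=> u ur; apply: srS; rewrite inE ur orbT.
have continue r x : {subset map seq_of r <= S} -> valid_log G r -> cut_state r x ->
    cut_state [::] (foldl F x r).
  elim: r x => //= s r IH x /sub [sS rS] /[dup] /andP [_ vr] vsr xP.
  by apply: IH; rewrite ?FE //; exact: dcut_state.
elim: L LS vL tL => //= -[l b] r IH /sub [sS rS] /[dup] vsr /andP [/allP sG vr].
rewrite inE F0 /=; case: eqP => [tb|_] /=; last exact: IH.
move=> _; apply: continue => //; rewrite -tb in sS *.
exists l, (Node (seq_of (l, t)) [::]), Leaf; split => //.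
- by apply: Tree_code (sequent_code_lseq _) _; exact: Trees_code_nil.
- exact: Cut_leaf.
Qed.

End Cuts.

(** * The slash *)

(** Used together with [X a], which is why atoms and [Bot] impose no condition. X may contain
    [Bot]. *)
Fixpoint slash (X : form -> Prop) (a : form) : Prop :=
  match a with
  | Atom _ | Bot => True
  | Or a0 a1 => (X a0 /\ slash X a0) \/ (X a1 /\ slash X a1)
  | And a0 a1 => (X a0 /\ slash X a0) /\ (X a1 /\ slash X a1)
  | Imp a0 a1 => X a0 /\ slash X a0 -> slash X a1
  end.

Definition closed_sequent (X : form -> Prop) (s : sequent) :=
  (forall a, a \in s.1 -> X a) -> X s.2.

Lemma sequents_of_node s ts u :
  (u \in sequents_of (Node s ts)) = (u == s) || has (fun t => u \in sequents_of t) ts.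
Proof.
rewrite /= !inE; congr orb.
by elim: ts => //= t ts IH; rewrite inE IH.
Qed.

Lemma NJp_node s d : NJp s d -> exists ts, d = Node s ts.
Proof. by case=> *; eexists. Qed.

Lemma NJp_root s d : NJp s d -> s \in sequents_of d.
Proof. by case/NJp_node => ts ->; rewrite sequents_of_node eqxx. Qed.

Lemma closed_children X s ts :
  (forall u, u \in sequents_of (Node s ts) -> closed_sequent X u) ->
  foldr (fun t Q => (forall u, u \in sequents_of t -> closed_sequent X u) /\ Q) True ts.
Proof.
move=> cl; have {}cl u : has (fun t => u \in sequents_of t) ts -> closed_sequent X u.
  by move=> uts; apply: cl; rewrite sequents_of_node uts orbT.
elim: ts cl => //= t ts IH cl; split=> [u ut|]; first by apply: cl; rewrite ut.
by apply: IH => u uts; apply: cl; rewrite uts orbT.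
Qed.

(** Membership in X follows from closure at every node, so the induction only has to establish the
    slash. *)
Lemma NJp_slash X s d : NJp s d ->
  (forall u, u \in sequents_of d -> closed_sequent X u) ->
  (forall a, a \in s.1 -> X a /\ slash X a) -> X s.2 /\ slash X s.2.
Proof.
move=> dP clX sX; split.
  by apply: (clX s) => [|a /sX []]; first exact: NJp_root.
have holds u e : NJp u e -> (forall v, v \in sequents_of e -> closed_sequent X v) ->
    (forall a, a \in u.1 -> X a /\ slash X a) -> slash X u.2 -> X u.2 /\ slash X u.2.
  by move=> /NJp_root uP cle uX; split=> //; apply: (cle u uP) => a /uX [].
have sub a (G : cedent) : X a /\ slash X a -> (forall c, c \in G -> X c /\ slash X c) ->
    forall c, c \in a |` G -> X c /\ slash X c.
  by move=> aX GX c; rewrite !inE => /predU1P [->|/GX].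
elim: dP clX sX => {s d}.
- by move=> G a _ GX; have [] := GX a (fset1U1 _ _).
- by [].
- move=> G a0 a1 b d d0 d1 dP IH dP0 IH0 dP1 IH1 cl GX.
  have [cld [cl0 [cl1 _]]] := closed_children cl.
  (* The slash of the disjunction selects the minor premise to follow. *)
  by have /= [aX|aX] := IH cld GX; [apply: IH0 | apply: IH1] => //; apply: sub.
- move=> G i a0 a1 d dP IH cl GX.
  have [cld _] := closed_children cl.
  have /= := holds _ _ dP cld GX (IH cld GX).
  by case: i {dP IH} => ?; [right | left].
- move=> G i a0 a1 d dP IH cl GX.
  have [cld _] := closed_children cl.
  by have /= [[_ ?] [_ ?]] := IH cld GX; case: i {cl GX}.
- move=> G a0 a1 d0 d1 dP0 IH0 dP1 IH1 cl GX.
  have [cl0 [cl1 _]] := closed_children cl.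
  split; first exact: (holds _ _ dP0 cl0 GX (IH0 cl0 GX)).
  exact: (holds _ _ dP1 cl1 GX (IH1 cl1 GX)).
- move=> G a b d0 d1 dP0 IH0 dP1 IH1 cl GX.
  have [cl0 [cl1 _]] := closed_children cl.
  exact: (IH0 cl0 GX (holds _ _ dP1 cl1 GX (IH1 cl1 GX))).
- move=> G a b d dP IH cl GX aX.
  have [cld _] := closed_children cl.
  by apply: IH => //; exact: sub.
Qed.

(** The sequents of [Cseq a] bring the strictly positive parts into X: both conjuncts, and the
    conclusion of an implication once its premise is in X. Being Harrop excludes disjunctions and is
    inherited by these parts. *)
Lemma Harrop_slash (X : form -> Prop) a :
  (forall u, u \in Cseq a -> closed_sequent X u) -> Harrop a -> X a -> slash X a.
Proof.
elim: a => //= [a0 _ a1 _|a0 IH0 a1 IH1|a0 _ a1 IH1] cl Ha Xa.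
- by case: (Ha a0 a1); exact: SP_self.
- have Xa0 : X a0.
    by apply: (cl ([fset And a0 a1], a0)) => [|c] /=; rewrite !inE ?eqxx // => /eqP ->.
  have Xa1 : X a1.
    by apply: (cl ([fset And a0 a1], a1)) => [|c] /=; rewrite !inE ?eqxx ?orbT // => /eqP ->.
  split; split=> //.
    apply: IH0 => // [u ua|b0 b1 sp]; first by apply: cl; rewrite !inE ua !orbT.
    by apply: (Ha b0 b1); exact: SP_and0.
  apply: IH1 => // [u ua|b0 b1 sp]; first by apply: cl; rewrite !inE ua !orbT.
  by apply: (Ha b0 b1); exact: SP_and1.
- move=> [Xa0 _]; apply: IH1 => [u ua|b0 b1 sp|].
  + by apply: cl; rewrite !inE ua !orbT.
  + by apply: (Ha b0 b1); exact: SP_imp.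
  + apply: (cl ([fset a0; Imp a0 a1], a1)) => [|c] /=; rewrite !inE ?eqxx //.
    by case/orP => /eqP ->.
Qed.

(** * Extraction of the available sequents *)

Scheme tree_code_ind2 := Minimality for tree_code Sort Prop
with trees_code_ind2 := Minimality for trees_code Sort Prop.

Notation forest_step := (worklist_step forest_c0 dtl forest_emit).

(** Quantifying over the rest of the stack and the output lets runs be chained. *)
Definition forest_run ts ys := forall stack out, exists m P,
  dwhile m forest_step (Pair (Pair ys stack) (lseqs_code out)) =
    Pair stack (lseqs_code (P ++ out)) /\
  forall u, (u \in map seq_of P) = has (fun t => u \in sequents_of t) ts.

Lemma sequent_codeP s x : sequent_code s x -> exists2 s0, seq_of s0 = s & x = lseq_code s0.
Proof.
case: s => G a [y [l lG ->] ->]; exists (l, a) => //.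
by congr (_, _); apply/fsetP => c; rewrite !inE lG.
Qed.

Lemma trees_code_run ts ys : trees_code ts ys -> forest_run ts ys.
Proof.
apply: (@trees_code_ind2 (fun t y => exists s ts s0 zs,
  [/\ t = Node s ts, y = Pair (lseq_code s0) zs, seq_of s0 = s & forest_run ts zs])).
- move=> s {}ts x {}ys /sequent_codeP [s0 s0E ->] _ run.
  by exists s, ts, s0, ys.
- by move=> stack out; exists 1, [::].
- move=> _ {}ts _ {}ys _ [s [ts0 [s0 [zs [-> -> s0E run0]]]]] _ run stack out.
  have [m0 [P0 [E0 P0E]]] := run0 (Pair ys stack) (s0 :: out).
  have [m [P [E PE]]] := run stack (P0 ++ s0 :: out).
  (* One round splits the list, [m0] rounds treat the premises and [m] the remaining trees. *)
  exists (1 + (m0 + m)), (P ++ rcons P0 s0); split.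
    by rewrite dwhileD -catA cat_rcons -E dwhileD -E0.
  move=> u; rewrite map_cat mem_cat PE map_rcons mem_rcons inE P0E s0E.
  by rewrite [has _ (_ :: _)]/= -sequents_of_node orbC.
Qed.

Lemma dsequents_code s ts x : tree_code (Node s ts) x ->
  exists2 P, dsequents (Pair (data_of_seq [:: data_of_seq [:: x]]) Leaf) = lseqs_code P
    & map seq_of P =i sequents_of (Node s ts).
Proof.
move=> dP; have /trees_code_run run : trees_code [:: Node s ts] (data_of_seq [:: x]).
  by apply: Trees_code_cons dP _; exact: Trees_code_nil.
have [m [P [E PE]]] := run Leaf [::]; exists P.
  by rewrite cats0 in E; apply: (worklistE forest_size (m := m)).
by move=> u; rewrite PE /= orbF.
Qed.

Notation form_step := (worklist_step form_c0 form_c1 form_emit).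

Lemma form_run a stack out : exists m P,
  dwhile m form_step (Pair (Pair (form_code a) stack) (lseqs_code out)) =
    Pair stack (lseqs_code (P ++ out)) /\ map seq_of P =i Cseq a.
Proof.
elim: a stack out => [p||a0 IH0 a1 IH1|a0 IH0 a1 IH1|a0 IH0 a1 IH1] stack out.
(* One round replaces the item by two copies of [Leaf], and two more drop them. *)
- by exists 3, [::].
- by exists 3, [::].
- by exists 3, [::].
- pose s0 : lseq := ([:: And a0 a1], a0); pose s1 : lseq := ([:: And a0 a1], a1).
  have [m0 [P0 [E0 P0E]]] := IH0 (Pair (form_code a1) stack) [:: s0, s1 & out].
  have [m1 [P1 [E1 P1E]]] := IH1 stack (P0 ++ [:: s0, s1 & out]).
  exists (1 + (m0 + m1)), (P1 ++ P0 ++ [:: s0; s1]); split.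
    by rewrite dwhileD -!catA -E1 dwhileD -E0.
  move=> u; rewrite !map_cat !mem_cat P0E P1E /= !inE.
  have sE b : seq_of ([:: And a0 a1], b) = ([fset And a0 a1], b).
    by congr (_, _); apply/fsetP => c; rewrite /= !inE ?orbF.
  rewrite !sE; case: (u \in Cseq a0); case: (u \in Cseq a1); rewrite ?orbT //=.
  by rewrite !orbF.
- pose s0 : lseq := ([:: a0; Imp a0 a1], a1).
  have [m [P [E PE]]] := IH1 stack (s0 :: out).
  (* The second round drops the [Leaf] standing for the premise of the implication. *)
  exists (2 + m), (rcons P s0); split.
    by rewrite dwhileD cat_rcons -E.
  move=> u; rewrite map_rcons mem_rcons inE PE /= !inE.
  have -> // : seq_of s0 = ([fset a0; Imp a0 a1], a1).
  by congr (_, _); apply/fsetP => c; rewrite /= !inE ?orbF.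
Qed.

Lemma forms_run l out : exists m P,
  dwhile m form_step (Pair (forms_code l) (lseqs_code out)) =
    Pair Leaf (lseqs_code (P ++ out)) /\
  forall u, (u \in map seq_of P) = has (fun a => u \in Cseq a) l.
Proof.
elim: l out => [|a l IH] out; first by exists 0, [::].
have [m0 [P0 [E0 P0E]]] := form_run a (forms_code l) out.
have [m [P [E PE]]] := IH (P0 ++ out).
exists (m0 + m), (P ++ P0); split; first by rewrite dwhileD -catA -E -E0.
by move=> u; rewrite map_cat mem_cat P0E PE /= orbC.
Qed.

Lemma dCseqs_code l Q : exists2 P,
  dCseqs (Pair (forms_code l) (lseqs_code Q)) = lseqs_code (P ++ Q)
  & forall u, (u \in map seq_of P) = has (fun a => u \in Cseq a) l.
Proof.
have [m [P [E PE]]] := forms_run l Q; exists P => //.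
exact: (worklistE form_size (m := m)).
Qed.

Lemma dhyps_code l :
  exists2 H, dhyps (forms_code l) = lseqs_code H
    & H =i [seq (l, a) | a <- l].
Proof.
rewrite /dhyps dfold_map -/(forms_code l).
have E out : foldl (fun r a => Pair (Pair (forms_code l) (form_code a)) r) (lseqs_code out)
    =1 fun k => lseqs_code (catrev [seq (l, a) | a <- k] out).
  by move=> k; elim: k out => //= a k IH out; rewrite -(IH ((l, a) :: out)).
exists (rev [seq (l, a) | a <- l]); first exact: (E [::]).
by move=> u; rewrite mem_rev.
Qed.

(** * Correctness of the algorithm *)

Lemma dmain_correct G a0 a1 d x :
  NJp (G, Or a0 a1) d -> Harrop_cedent G -> tree_code d x ->
  exists (i : bool) (G' : cedent) (e : tree),
    [/\ answer_code i e (dmain x), G' `<=` G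
      & cut_deduction (cut_premises G d) (G', if i then a1 else a0) e].
Proof.
move=> dP HG; have [ts dE] := NJp_node dP; rewrite {}dE in dP * => dx.
have [Q QE memQ] := dsequents_code dx.
(* The algorithm sees [G] only as the list [l] written at the root of [x]. *)
have [l lG [ys xE]] : exists2 l, l =i G & exists ys, x = Pair (lseq_code (l, Or a0 a1)) ys.
  inversion dx as [s' ts' y ys sy tsys e1 e2]; have [[l b] [lG bE] ->] := sequent_codeP sy.
  by exists l; [move=> a; rewrite -lG !inE | exists ys; rewrite bE].
have [P PQ memP] := dCseqs_code l Q.
have [H HE memH] := dhyps_code l.
set S := P ++ Q; pose L := saturate S H.
have LE : dlog x = lseqs_code L.
  rewrite /dlog /dpremises QE xE [dhd (dhd _)]/= PQ HE.
  exact: dsaturate_code.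
pose X a := a \in map snd L.
have clX s : s \in map seq_of S -> closed_sequent X s.
  case/mapP=> {}s sS -> /= sX.
  have /allP /(_ s sS) /implyP := saturate_closed S H; apply.
  by apply/allP => a sa; apply: sX; rewrite inE.
have clQ s : s \in sequents_of (Node (G, Or a0 a1) ts) -> closed_sequent X s.
  by rewrite -memQ => sQ; apply: clX; rewrite map_cat mem_cat sQ orbT.
have GX a : a \in G -> X a /\ slash X a.
  move=> aG.
  have Xa : X a.
    have aH : (l, a) \in H by rewrite memH; apply: map_f; rewrite lG.
    exact: (map_f snd (saturate_sub _ aH)).
  split=> //; apply: Harrop_slash => //; last exact: HG.
  move=> s sa; apply: clX; rewrite map_cat mem_cat memP.
  by apply/orP; left; apply/hasP; exists a; rewrite ?lG.
have LS : {subset map seq_of L <= cut_premises G (Node (G, Or a0 a1) ts)}.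
  move=> _ /mapP [s /saturate_mem sL ->]; rewrite /cut_premises 2!in_fsetU.
  move: sL; rewrite mem_cat memH => /orP [|/mapP [a al ->]]; last first.
    apply/orP; left; apply/orP; right; apply/imfsetP; exists a => /=; first by rewrite -lG.
    by congr (_, _); apply/fsetP => c; rewrite !inE lG.
  rewrite mem_cat => /orP [/(map_f seq_of)|/(map_f seq_of)].
    rewrite memP => /hasP [a al sa]; apply/orP; right.
    by apply/bigfcupP; exists a => //; rewrite -lG al.
  by rewrite memQ => ->.
have vL : valid_log l L.
  apply: saturate_valid.
  have: {subset H <= [seq (l, a) | a <- l]} by move=> s; rewrite memH.
  elim: (H) => //= s r IH sub; rewrite IH => [|t tr]; last by rewrite sub // inE tr orbT.
  have /mapP [a _ ->] := sub s (mem_head _ _).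
  by rewrite andbT; apply/allP => c /= ->.
have XE a : succ_in (form_code a) (lseqs_code L) = of_bool (a \in map snd L).
  exact: succ_in_code.
pose i := a1 \in map snd L; pose t := if i then a1 else a0.
(* The slash of the disjunction puts a disjunct into X; if it is not [a1], it is [a0]. *)
have tL : t \in map snd L.
  have [_ /= [[]|[]]] := NJp_slash dP clQ GX; rewrite /t /i /X; case: ifP => // -> //.
have [m [e [y [mE eP cutP mG]]]] := dcuts_state LS vL tL.
exists i, [fset a in m], e; split => //.
- exists (dcuts (form_code t) (lseqs_code L)); first exact: eP.
  rewrite /dmain LE xE /= XE dif_bool -/i.
  by rewrite /t; case: (i).
- by apply/fsubsetP => a; rewrite !inE => /mG; rewrite !inE orbF lG.
Qed.

Theorem theorem3p11 :
  exists (c : cmd) (k : nat),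
  forall (G : cedent) (a0 a1 : form) (d : tree) (x : data),
    NJp (G, Or a0 a1) d -> Harrop_cedent G -> tree_code d x ->
    exists (y : data) (n : nat),
      [/\ computes c x y n,
          (n <= k * dsize x ^ k)%N
        & exists (i : bool) (G' : cedent) (e : tree),
            [/\ answer_code i e y,
                G' `<=` G
              & cut_deduction (cut_premises G d)
                  (G', if i then a1 else a0) e]].
Proof.
have [c [T [[k Tk] _ cP]]] := polytime_main.
(* Based at 0, the program finds its input and leaves its output in variable 0. *)
exists (c 0), k => G a0 a1 d x dP HG dx.
have [s [n [run out _ time]]] := cP 0 (update (fun=> Leaf) 0 x).
exists (dmain x), n; split.
- by exists s.
- exact: leq_trans time (Tk x).
- exact: dmain_correct dP HG dx.
Qed.
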